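(* Let $\alpha_1=1$ and $\alpha_k=\alpha_{k-1}^2+3\alpha_{k-1}+1$ for $k>1$. For every $k\ge1$, there does not exist a randomized memoryless algorithm for the weighted $k$-server problem on uniform metric spaces whose competitive ratio against an online adaptive adversary is less than $\alpha_k$.
   Context: Weighted $k$-server problem on uniform metric spaces: a uniform metric space is a set of points in which any two distinct points are at distance $1$. There are $k$ servers with weights $\beta_1,\dots,\beta_k>0$, each located at a point; moving server $i$ to a different point costs $\beta_i$. Requests (points) arrive online; each request must be served, before the next one is revealed, by having some server at the requested point. A randomized memoryless algorithm on uniform spaces is specified, for each weight vector $\beta$, by a probability distribution $(p_1,\dots,p_k)$ on the servers: whenever the requested point is not occupied by any of its servers, it moves server $i$ to that point with probability $p_i$, independently of the past; otherwise it does nothing. An online adaptive adversary generates each request after observing the algorithm's behaviour on all previous requests and immediately serves it with its own $k$ servers of the same weights. The algorithm is $c$-competitive against online adaptive adversaries if there is a constant $b$ such that for every such adversary and every weight vector, $\mathbb{E}[\text{cost of algorithm}]\le c\cdot\mathbb{E}[\text{cost of adversary}]+b$; its competitive ratio is the infimum of such $c$. *)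

(* Defs.v *)
From mathcomp Require Import all_boot all_order all_algebra.
From mathcomp Require Import boolp classical_sets reals ereal.

Set Implicit Arguments.
Unset Strict Implicit.
Unset Printing Implicit Defensive.

Import Order.TTheory GRing.Theory Num.Theory.

Local Open Scope ring_scope.

(* The value at 0 is a dummy: the sequence starts at index 1. *)
Fixpoint alpha (k : nat) : nat :=
  match k with
  | 0 => 0%N
  | 1 => 1%N
  | k'.+1 => (alpha k' ^ 2 + 3 * alpha k' + 1)%N
  end.

(* A uniform metric space is a bare set of points T with this distance. *)
Definition udist (R : realType) (T : eqType) (x y : T) : R := (x != y)%:R.

(* The positions of the k servers; several servers may share a point. *)
Definition config (k : nat) (T : eqType) := {ffun 'I_k -> T}.

Definition move_cost (R : realType) (k : nat) (T : eqType)
    (beta : 'I_k -> R) (s s' : config k T) : R :=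
  \sum_(i < k) beta i * udist R (s i) (s' i).

(* The distribution may depend on the weights, but neither on the space, nor on
   the configuration, nor on the past. Values at weight vectors that are not
   positive are irrelevant. *)
Record memoryless_alg (R : realType) (k : nat) := MemorylessAlg {
  server_prob :> ('I_k -> R) -> 'I_k -> R ;
  server_prob_ge0 : forall beta : 'I_k -> R, (forall i, 0 < beta i) ->
    forall i, 0 <= server_prob beta i ;
  server_prob_sum1 : forall beta : 'I_k -> R, (forall i, 0 < beta i) ->
    \sum_(i < k) server_prob beta i = 1
}.

(* The algorithm in configuration s answers the request r; i is the server
   drawn at random, which is only used when r is not occupied. *)
Definition alg_step (k : nat) (T : eqType) (s : config k T) (r : T) (i : 'I_k)
    : config k T :=
  if r \in codom s then s else [ffun j => if j == i then r else s j].

(* The argument h of adv_request and adv_serve is what the adversary has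
   observed when it acts: the algorithm's configurations after each of the
   previous requests, oldest first. Given h, the adversary issues adv_request h
   and, before seeing the algorithm's answer to it, moves its own servers to
   adv_serve h, where any of them may move. *)
Record adversary (k : nat) (T : eqType) := Adversary {
  adv_request : seq (config k T) -> T ;
  adv_serve : seq (config k T) -> config k T ;
  adv_serveP : forall h, adv_request h \in codom (adv_serve h)
}.

(* In both costs, s is the current configuration of the algorithm, h is the
   history observed so far, and w lists the servers drawn at random for the
   size w requests still to come; a is the adversary's current configuration. *)
Fixpoint alg_cost (R : realType) (k : nat) (T : eqType) (beta : 'I_k -> R)
    (adv : adversary k T) (s : config k T) (h : seq (config k T))
    (w : seq 'I_k) : R :=
  if w is i :: w' then
    let s' := alg_step s (adv_request adv h) i in
    move_cost beta s s' + alg_cost beta adv s' (rcons h s') w'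
  else 0.

Fixpoint adv_cost (R : realType) (k : nat) (T : eqType) (beta : 'I_k -> R)
    (adv : adversary k T) (a s : config k T) (h : seq (config k T))
    (w : seq 'I_k) : R :=
  if w is i :: w' then
    let s' := alg_step s (adv_request adv h) i in
    let a' := adv_serve adv h in
    move_cost beta a a' + adv_cost beta adv a' s' (rcons h s') w'
  else 0.

(* Expectation of X over n independent draws from the distribution p. *)
Definition expect (R : realType) (k n : nat) (p : 'I_k -> R)
    (X : seq 'I_k -> R) : R :=
  \sum_(w : n.-tuple 'I_k) (\prod_(i <- w) p i) * X w.

(* Both players start from the same configuration s0, and n is the number of
   requests. *)
Definition competitive (R : realType) (k : nat) (A : memoryless_alg R k)
    (c : R) : Prop :=
  forall (T : eqType) (s0 : config k T),
  exists b : R,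
  forall beta : 'I_k -> R, (forall i, 0 < beta i) ->
  forall (adv : adversary k T) (n : nat),
    expect n (A beta) (alg_cost beta adv s0 [::]) <=
    c * expect n (A beta) (adv_cost beta adv s0 s0 [::]) + b.

(* The infimum is +oo when A is not c-competitive for any c. *)
Definition competitive_ratio (R : realType) (k : nat) (A : memoryless_alg R k)
    : \bar R :=
  ereal_inf [set c%:E | c in [set c : R | competitive A c]%classic]%classic.

(* Main.v *)
Require Import Defs.
From mathcomp Require Import all_boot all_order all_algebra.
From mathcomp Require Import boolp classical_sets reals ereal.
From mathcomp Require Import ring lra.

(* The adversary keeps its servers at distinct points a_l and always requests
   a_l for the least l such that the algorithm's l-th server is not at a_l.
   Whenever the algorithm moves server i, the adversary moves its servers l < i
   to fresh points; if the weights grow fast, this costs a negligible fraction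
   of what the algorithm pays. The pattern of the indices l with s_l = a_l then
   evolves like a random binary counter. In strategy j, whenever s_m = a_m for
   all m >= j, the adversary also moves a_j to a fresh point.  With indices
   starting at 0, strategy j makes the adversary pay per request at most
   beta_j p_j (alpha_j + 2) / (alpha_k + 1), up to the negligible part, while
   the algorithm pays sum_j p_j beta_j in expectation. Averaging over j with
   weights 1 / (alpha_j + 2), whose sum is alpha_k / (alpha_k + 1), shows that
   one of the strategies forces a ratio close to alpha_k. *)

Set Implicit Arguments.
Unset Strict Implicit.
Unset Printing Implicit Defensive.

Import Order.TTheory GRing.Theory Num.Theory.

Local Open Scope ring_scope.

(** The dummy value [alpha 0 = 0] satisfies the recurrence too, so indices can start at 0. *)
Lemma alphaS (n : nat) : alpha n.+1 = (alpha n ^ 2 + 3 * alpha n + 1)%N.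
Proof. by case: n. Qed.

(** * Potentials of the random binary counter *)

Section Potential.

Variables (R : realFieldType) (p : nat -> R).

Definition alphar (n : nat) : R := (alpha n)%:R.

Lemma alphar_ge0 n : 0 <= alphar n. Proof. exact: ler0n. Qed.

Lemma alpharS1 n : alphar n.+1 + 1 = (alphar n + 1) * (alphar n + 2).
Proof. by rewrite /alphar alphaS !natrD !natrM; ring. Qed.

Lemma alphar1_gt0 n : 0 < alphar n + 1. Proof. by have := alphar_ge0 n; lra. Qed.
Lemma alphar2_gt0 n : 0 < alphar n + 2. Proof. by have := alphar_ge0 n; lra. Qed.

(** The sum telescopes: by [alpharS1], [1 / (alphar j + 2)] is [1 / (alphar j + 1) - 1 / (alphar
    j.+1 + 1)]. *)
Lemma sum_inv_alphar2 k : \sum_(j < k) (alphar j + 2)^-1 = alphar k / (alphar k + 1).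
Proof.
elim: k => [|k IH]; first by rewrite big_ord0 /alphar /= mul0r.
rewrite big_ord_recr /= IH alpharS1.
have -> : alphar k.+1 = (alphar k + 1) * (alphar k + 2) - 1 by rewrite -alpharS1; ring.
have h1 := alphar1_gt0 k; have h2 := alphar2_gt0 k.
by field; rewrite !gt_eqF.
Qed.

(* Bit l of h tells whether s_l = a_l. The request goes to the lowest zero bit;
   i is the server that the algorithm moves. *)
Definition counter_step (h : nat -> bool) (i n : nat) : bool :=
  if (n < i)%N then false
  else if n == i then ~~ h i && [forall l : 'I_i, h l] else h n.

(* Certifies that the bits below m are all set at long-run frequency at most
   1 / (alpha_m + 1), see psi_step. When p m' = 0 the coefficient A is 0: this
   is only correct because bit m' then stays clear. *)
Fixpoint psi (m : nat) (h : nat -> bool) : R :=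
  if m is m'.+1 then
    let A := (alphar m' + 2)^-1 / p m' in
    if h m' then A + psi m' h else p m' * A * psi m' h
  else 0.

(* Long-run frequency at which strategy j moves a_j in the game on the servers
   below m. *)
Definition rate (j m : nat) : R := p j * (alphar j + 2) / (alphar m + 1).

(* Potential of strategy j on the servers up to j + d, in units of beta_j. By
   phi_pay it drops by exactly 1 when a_j is moved away. *)
Fixpoint phi (j d : nat) (h : nat -> bool) : R :=
  if d is d'.+1 then
    let m := (j + d'.+1)%N in
    let B := rate j m.+1 * (alphar m + 1) / p m in
    if h m then B + phi j d' h else p m * B * psi m h
  else (h j)%:R + p j * psi j h.

Lemma rate0 j : rate j j.+1 = p j / (alphar j + 1).
Proof.
rewrite /rate alpharS1; have h1 := alphar1_gt0 j; have h2 := alphar2_gt0 j.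
by field; rewrite !gt_eqF.
Qed.

Lemma rateS j m : rate j m = rate j m.+1 * (alphar m + 2).
Proof.
rewrite /rate alpharS1; have h1 := alphar1_gt0 m; have h2 := alphar2_gt0 m.
by field; rewrite !gt_eqF.
Qed.

Lemma counter_step_gt h i n : (i < n)%N -> counter_step h i n = h n.
Proof.
move=> lt_in; rewrite /counter_step ltnNge (ltnW lt_in) /=.
by rewrite gtn_eqF.
Qed.

Lemma counter_step_lt h i n : (n < i)%N -> counter_step h i n = false.
Proof. by rewrite /counter_step => ->. Qed.

Lemma counter_step_id h i :
  counter_step h i i = ~~ h i && [forall l : 'I_i, h l].
Proof. by rewrite /counter_step ltnn eqxx. Qed.

Lemma forall_ordS (h : nat -> bool) m :
  [forall l : 'I_m.+1, h l] = h m && [forall l : 'I_m, h l].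
Proof.
apply/forallP/andP => [H|[hm /forallP H] l].
  split; first exact: (H ord_max).
  by apply/forallP => l; apply: (H (widen_ord (leqnSn m) l)).
case: (ltnP l m) => lm; first exact: (H (Ordinal lm)).
suff -> : (l : nat) = m by [].
by apply/eqP; rewrite eqn_leq lm -ltnS ltn_ord.
Qed.

Lemma eq_psi m (h h' : nat -> bool) :
  (forall n, (n < m)%N -> h n = h' n) -> psi m h = psi m h'.
Proof.
elim: m => //= m IH E; rewrite E // IH // => n nm.
by apply: E; apply: ltnW.
Qed.

Lemma eq_phi j d (h h' : nat -> bool) : (forall n, (n < (j + d).+1)%N -> h n = h' n) ->
  phi j d h = phi j d h'.
Proof.
elim: d => /= [|d IH] E.
  by rewrite E ?addn0 // (@eq_psi j h h') // => n nj; apply: E; rewrite addn0 ltnW.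
rewrite E // IH ?(@eq_psi (j + d.+1) h h') // => n nj; apply: E => //.
  by apply: ltnW.
by rewrite addnS ltnW.
Qed.

Lemma psi0 m (h : nat -> bool) : (forall n, (n < m)%N -> h n = false) -> psi m h = 0.
Proof.
elim: m => //= m IH E; rewrite E // IH ?mulr0 // => n nm.
by apply: E; apply: ltnW.
Qed.

Lemma phi0 j d (h : nat -> bool) : (forall n, (n < (j + d).+1)%N -> h n = false) ->
  phi j d h = 0.
Proof.
case: d => /= [|d] E.
  rewrite E ?addn0 // psi0 ?mulr0 ?addr0 // => n nj.
  by apply: E; rewrite addn0 ltnW.
by rewrite E // psi0 ?mulr0 // => n nj; apply: E; apply: ltnW.
Qed.

Hypothesis p_ge0 : forall n, 0 <= p n.

Lemma psi_ge0 m h : 0 <= psi m h.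
Proof.
elim: m => //= m IH.
have A0 : 0 <= (alphar m + 2)^-1 / p m.
  by rewrite divr_ge0 // invr_ge0 ltW // alphar2_gt0.
case: (h m).
  by rewrite addr_ge0.
by apply: mulr_ge0 => //; apply: mulr_ge0.
Qed.

Lemma rate_ge0 j m : 0 <= rate j m.
Proof. by rewrite divr_ge0 ?mulr_ge0 // ltW ?alphar1_gt0 ?alphar2_gt0. Qed.

Lemma phi_ge0 j d h : 0 <= phi j d h.
Proof.
elim: d => /= [|d IH]; first by rewrite addr_ge0 ?ler0n // mulr_ge0 ?psi_ge0.
set m := (j + d.+1)%N.
have B0 : 0 <= rate j m.+1 * (alphar m + 1) / p m.
  by rewrite divr_ge0 // mulr_ge0 ?rate_ge0 // ltW ?alphar1_gt0.
case: (h m).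
  by rewrite addr_ge0.
by apply: mulr_ge0; [apply: mulr_ge0 | apply: psi_ge0].
Qed.

Lemma phi_pay j d (h : nat -> bool) : (forall n, (j <= n < (j + d).+1)%N -> h n) ->
  phi j d h = 1 + phi j d (fun n => (n != j) && h n).
Proof.
elim: d => /= [|d IH] E.
  rewrite eqxx E ?addn0 ?leqnn //= add0r (@eq_psi j _ h) // => n nj.
  by rewrite ltn_eqF.
rewrite E ?leq_addr ?leqnn //= ?gtn_eqF -?addnS ?leq_addr //=; last first.
  by rewrite -[X in (X < _)%N]addn0 ltn_add2l.
rewrite IH; first by ring.
move=> n /andP[jn nd]; apply: E; rewrite jn /=.
by apply: leq_trans nd _; rewrite addnS ltnW.
Qed.

(** Induction, splitting on the top bit [m]. If it is set, a move of server [m] clears it, and the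
    expected loss [p m * A = 1 / (alphar m + 2)] turns [1 / (alphar m + 1)] into
    [1 / (alphar m.+1 + 1)]. If it is clear, it can only become set when all lower bits are set, so
    the bound for the lower bits, scaled by [p m * A], suffices. *)
Lemma psi_step m (h : nat -> bool) :
  \sum_(i < m) p i <= 1 -> (forall n, (n < m)%N -> h n -> p n != 0) ->
  [forall l : 'I_m, h l]%:R + \sum_(i < m) p i * psi m (counter_step h i) <=
    psi m h + (alphar m + 1)^-1.
Proof.
elim: m => [|m IH] p1 hp.
  rewrite big_ord0 /= addr0 add0r /alphar /= add0r invr1.
  by case: [forall _, _].
move: p1; rewrite big_ord_recr /= => p1.
have pm0 := p_ge0 m.
have /IH {}IH : \sum_(i < m) p i <= 1 by lra.
have {}IH := IH (fun n nm => hp n (ltnW nm)).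
have a1 := alphar1_gt0 m; have a2 := alphar2_gt0 m.
rewrite big_ord_recr /= counter_step_id forall_ordS (@psi0 m (counter_step h m)); last first.
  by move=> n; apply: counter_step_lt.
set A := _ / p m; have A0 : 0 <= A.
  by rewrite divr_ge0 // invr_ge0 ltW.
rewrite alpharS1; set S := \sum_(i < m) _.
case: (boolP (h m)) => hm /=; rewrite ?mulr0 ?addr0.
  have -> : S = A * (\sum_(i < m) p i) +
      \sum_(i < m) p i * psi m (counter_step h i).
    rewrite /S mulr_sumr -big_split; apply: eq_bigr => i _ /=.
    by rewrite counter_step_gt // hm mulrDr mulrC.
  have pA : p m * A = (alphar m + 2)^-1 by rewrite /A; field; rewrite hp // gt_eqF.
  have pA' : A * (\sum_(i < m) p i) <= A - (alphar m + 2)^-1.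
    by rewrite -pA; have := ler_wpM2l A0 p1; lra.
  have -> : ((alphar m + 1) * (alphar m + 2))^-1 = (alphar m + 1)^-1 - (alphar m + 2)^-1.
    by field; rewrite !gt_eqF.
  by move: IH pA'; lra.
have -> : S = p m * A * \sum_(i < m) p i * psi m (counter_step h i).
  rewrite /S mulr_sumr; apply: eq_bigr => i _ /=.
  by rewrite counter_step_gt // (negbTE hm); ring.
have pA : p m * A <= (alphar m + 2)^-1.
  have [->|pn0] := eqVneq (p m) 0; first by rewrite mul0r invr_ge0 ltW.
  by rewrite /A mulrCA divff // mulr1.
have := ler_wpM2l (mulr_ge0 pm0 A0) IH; rewrite invfM.
have i1 : 0 <= (alphar m + 1)^-1 by rewrite invr_ge0 ltW.
have := ler_wpM2r i1 pA.
rewrite !mulrDr.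
by case: [forall _, _] => /=; rewrite ?mulr0 ?mulr1; lra.
Qed.

(** Induction, splitting on the top bit [m]. If it is set, the risk of clearing it loses [p m * B],
    which is the difference between [rate j m] and [rate j m.+1]. If it is clear, strategy [j]
    cannot pay before all bits below [m] have been set, an event whose frequency [psi_step]
    controls. *)
Lemma phi_step j d (h : nat -> bool) :
  \sum_(i < (j + d).+1) p i <= 1 ->
  (forall n, (n < (j + d).+1)%N -> h n -> p n != 0) ->
  (exists2 n, (j <= n < (j + d).+1)%N & ~~ h n) ->
  \sum_(i < (j + d).+1) p i * phi j d (counter_step h i) <=
    phi j d h + rate j (j + d).+1.
Proof.
elim: d => [|d IH] p1 hp [n0 n0P hn0].
  rewrite addn0 in p1 hp n0P *; rewrite rate0.
  have {n0P}E : n0 = j by apply/eqP; rewrite eqn_leq andbC.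
  rewrite {}E in hn0; rewrite big_ord_recr /= in p1; rewrite big_ord_recr /=.
  have a1 := alphar1_gt0 j; have pj0 := p_ge0 j.
  rewrite counter_step_id hn0 (negbTE hn0) /= (@psi0 j (counter_step h j)); last first.
    by move=> n; apply: counter_step_lt.
  have /psi_step K : \sum_(i < j) p i <= 1 by lra.
  have {K} := ler_wpM2l pj0 (K h (fun n nm => hp n (ltnW nm))).
  rewrite !mulrDr mulr_sumr => K.
  rewrite (eq_bigr (fun i : 'I_j => p j * (p i * psi j (counter_step h i)))).
    by lra.
  by move=> i _; rewrite counter_step_gt // (negbTE hn0) add0r mulrCA.
rewrite addnS in p1 hp n0P *; set m := (j + d).+1 in p1 hp n0P IH *.
rewrite big_ord_recr /= in p1; rewrite big_ord_recr /=; rewrite addnS -/m.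
have pm0 := p_ge0 m; have pS : \sum_(i < m) p i <= 1 by lra.
have hp' n : (n < m)%N -> h n -> p n != 0 by move=> nm; apply: hp; apply: ltnW.
have a1 := alphar1_gt0 m; have a2 := alphar2_gt0 m.
rewrite counter_step_id (@psi0 m (counter_step h m)); last first.
  by move=> n; apply: counter_step_lt.
rewrite (@phi0 j d (counter_step h m)); last by move=> n; apply: counter_step_lt.
have r0 := rate_ge0 j m.+1.
set B := _ / p m; have B0 : 0 <= B by rewrite divr_ge0 // mulr_ge0 // ltW.
set S := \sum_(i < m) _.
case: (boolP (h m)) => hm /=; rewrite ?mulr0 ?addr0.
  have -> : S = B * (\sum_(i < m) p i) +
      \sum_(i < m) p i * phi j d (counter_step h i).
    rewrite /S mulr_sumr -big_split; apply: eq_bigr => i _ /=.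
    by rewrite counter_step_gt // hm mulrDr mulrC.
  have pB : p m * B = rate j m.+1 * (alphar m + 1).
    by rewrite /B mulrCA divff ?mulr1 // hp.
  have {}IH : \sum_(i < m) p i * phi j d (counter_step h i) <= phi j d h + rate j m.
    apply: IH => //; exists n0 => //.
    move: n0P => /andP[-> /=]; rewrite ltnS leq_eqVlt => /orP[/eqP E|//].
    by rewrite E hm in hn0.
  rewrite (rateS j m) in IH.
  by have := ler_wpM2l B0 p1; move: IH pB; rewrite !mulrDr; lra.
have -> : S = p m * B * \sum_(i < m) p i * psi m (counter_step h i).
  rewrite /S mulr_sumr; apply: eq_bigr => i _ /=.
  by rewrite counter_step_gt // (negbTE hm); ring.
have pB : p m * B * (alphar m + 1)^-1 <= rate j m.+1.
  rewrite /B; have [->|pn0] := eqVneq (p m) 0; first by rewrite !mul0r.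
  by rewrite le_eqVlt; apply/orP; left; apply/eqP; field; rewrite pn0 gt_eqF.
have := ler_wpM2l (mulr_ge0 pm0 B0) (psi_step pS hp').
rewrite !mulrDr.
by case: [forall _, _] => /=; rewrite ?mulr0 ?mulr1 ?addr0; move: pB; lra.
Qed.

End Potential.

(** * Expectation over independent draws *)

Lemma expectS (R : realType) (k n : nat) (p : 'I_k -> R) (X : seq 'I_k -> R) :
  expect n.+1 p X = \sum_(i < k) p i * expect n p (fun w => X (i :: w)).
Proof.
rewrite /expect (reindex (fun iw : 'I_k * n.-tuple 'I_k => cons_tuple iw.1 iw.2)) /=.
  under [RHS]eq_bigr do rewrite mulr_sumr.
  rewrite pair_bigA /=; apply: eq_bigr => -[i w] _ /=.
  by rewrite big_cons mulrA.
exists (fun w => (thead w, [tuple of behead w])) => [[i w]|w] _ /=.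
  by congr pair; apply: val_inj.
by rewrite [RHS]tuple_eta; apply: val_inj.
Qed.

Lemma expect0 (R : realType) (k : nat) (p : 'I_k -> R) (X : seq 'I_k -> R) :
  expect 0 p X = X [::].
Proof.
rewrite /expect (eq_bigr (fun=> X [::])) => [|w _]; last first.
  by rewrite tuple0 big_nil mul1r.
by rewrite sumr_const card_tuple expn0.
Qed.

Lemma expect_const (R : realType) (k n : nat) (p : 'I_k -> R) (c : R)
    (X : seq 'I_k -> R) : \sum_(i < k) p i = 1 ->
  expect n p (fun w => c + X w) = c + expect n p X.
Proof.
move=> p1; elim: n X => [|n IH] X; first by rewrite !expect0.
rewrite !expectS; under eq_bigr do rewrite IH mulrDr.
by rewrite big_split /= -mulr_suml p1 mul1r.
Qed.

(** * Fresh points, with the natural numbers as the space *)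

Section Refresh.

Variables (k : nat).
Implicit Types (s a : config k nat) (D : pred 'I_k).

Definition fresh s a : nat := (\max_(i < k) maxn (s i) (a i)).+1.

(** The offset [l] keeps the new points distinct from one another. *)
Definition refresh s a D : config k nat :=
  [ffun l : 'I_k => if D l then (fresh s a + l)%N else a l].

Lemma lt_fresh s a (i : 'I_k) : (s i < fresh s a)%N /\ (a i < fresh s a)%N.
Proof.
have := leq_bigmax (F := fun i : 'I_k => maxn (s i) (a i)) i.
by rewrite /fresh geq_max => /andP[]; rewrite !ltnS.
Qed.

Lemma refresh_neq s a D (l m : 'I_k) : D l -> s m != refresh s a D l.
Proof.
move=> Dl; rewrite ffunE Dl ltn_eqF //; have [lt_s _] := lt_fresh s a m.
exact: leq_trans lt_s (leq_addr _ _).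
Qed.

Lemma refreshF s a D (l : 'I_k) : ~~ D l -> refresh s a D l = a l.
Proof. by rewrite ffunE => /negbTE ->. Qed.

Lemma refresh_inj s a D : {in [predC D] &, injective a} ->
  injective (refresh s a D).
Proof.
move=> a_inj l m; rewrite !ffunE.
have [_ alphar] := lt_fresh s a l; have [_ am] := lt_fresh s a m.
case: ifPn => Dl; case: ifPn => Dm.
- by move=> /addnI /val_inj.
- by move=> E; move: am; rewrite -E -ltn_subRL subnn.
- by move=> E; move: alphar; rewrite E -ltn_subRL subnn.
exact: a_inj.
Qed.

End Refresh.

(** * Strategy [j] and its simulation by the counter *)

Section Chase.

Variables (k : nat) (j : 'I_k).
Implicit Types (s a : config k nat).

(** The default [j] is never reached in a [valid] state, see [targetP]. *)
Definition target s a : 'I_k :=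
  odflt j [pick l | (s l != a l) && [forall m : 'I_k, (m < l)%N ==> (s m == a m)]].

Definition all_caught s a : bool :=
  [forall m : 'I_k, (j <= m)%N ==> (s m == a m)].

(** The adversary observes configurations, not draws, so the moved server [i] is recovered by
    comparing [s] with [s']. *)
Definition overtaken s s' a : pred 'I_k := fun l =>
  [exists i : 'I_k, (l < i)%N && (s i != s' i)] || (l == j) && all_caught s' a.

(* The first component is the algorithm's last configuration, the second one the
   adversary's. *)
Definition react (sa : config k nat * config k nat) s' :=
  (s', refresh s' sa.2 (overtaken sa.1 s' sa.2)).

Definition start s := (s, refresh s s predT).

(** The refresh decided after an answer is carried out when the next request is served; that request
    is then at one of the relocated servers. *)
Definition chase_state s0 (h : seq (config k nat)) := foldl react (start s0) h.

Definition chase_request s0 h :=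
  let sa := chase_state s0 h in sa.2 (target sa.1 sa.2).

Lemma chase_serveP s0 h : chase_request s0 h \in codom (chase_state s0 h).2.
Proof. exact: codom_f. Qed.

Definition chase s0 : adversary k nat := Adversary (chase_serveP s0).

Variables (R : realType) (p : 'I_k -> R).

(** The first two fields make every request unoccupied; [valid_escape] provides a target and the
    clear bit asked for by [phi_step]; [valid_pos] excludes set bits of probability 0. *)
Record valid s a : Prop := Valid {
  valid_inj : injective a;
  valid_neq : forall l m : 'I_k, (l < m)%N -> s m != a l;
  valid_escape : exists2 m : 'I_k, (j <= m)%N & s m != a m;
  valid_pos : forall m : 'I_k, s m = a m -> p m != 0
}.

Lemma valid_start s : valid s (start s).2.
Proof.
split=> /=.
- by apply: refresh_inj => l m; rewrite !inE.
- by move=> l m _; apply: refresh_neq.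
- by exists j => //; apply: refresh_neq.
by move=> m /eqP; rewrite (negbTE (refresh_neq _ _ _ _)).
Qed.

Definition matched s a (n : nat) : bool :=
  oapp (fun i : 'I_k => s i == a i) false (insub n).

Lemma matchedE s a (i : 'I_k) : matched s a i = (s i == a i).
Proof. by rewrite /matched valK. Qed.

Section Step.

Variables (s a : config k nat).
Hypothesis sa_valid : valid s a.

Let t := target s a.

Lemma targetP : s t != a t /\ forall m : 'I_k, (m < t)%N -> s m = a m.
Proof.
rewrite /t /target; case: pickP => [l /andP[-> /forallP H]|none] /=.
  by split=> // m ml; apply/eqP; exact: (implyP (H m)).
have [m0 _ m0P] := valid_escape sa_valid.
case: (@arg_minnP _ m0 (fun m => s m != a m) (fun m => m : nat) m0P) => l lP l_min.
have /negP[] := none l; rewrite lP; apply/forallP => m; apply/implyP => ml.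
by apply: contraTT ml => /l_min; rewrite -leqNgt.
Qed.

Lemma target_free : a t \notin codom s.
Proof.
have [tP t_min] := targetP.
apply/negP => /codomP[m E].
case: (ltngtP m t) => [mt|tm|/val_inj mt].
- have tm : t = m by apply: (valid_inj sa_valid); rewrite E t_min.
  by rewrite tm ltnn in mt.
- by have /eqP[] := valid_neq sa_valid tm; rewrite -E.
by rewrite mt in E; rewrite E eqxx in tP.
Qed.

Variable i : 'I_k.

Let s' := alg_step s (a t) i.
Let a' := (react (s, a) s').2.

Lemma alg_stepE (m : 'I_k) : s' m = if m == i then a t else s m.
Proof. by rewrite /s' /alg_step (negbTE target_free) ffunE. Qed.

Lemma alg_step_neq (m : 'I_k) : (s m != s' m) = (m == i).
Proof.
rewrite alg_stepE; have [->|_] := eqVneq m i; last by rewrite eqxx.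
by apply: contraNneq target_free => <-; exact: codom_f.
Qed.

Lemma overtakenE l :
  overtaken s s' a l = (l < i)%N || (l == j) && all_caught s' a.
Proof.
congr orb; apply/existsP/idP => [[m]|li]; last by exists i; rewrite li alg_step_neq /=.
by rewrite alg_step_neq => /andP[lm /eqP <-].
Qed.

(** If [j < i], the move of [a_j] is already counted among the refreshes of the servers below
    [i]. *)
Definition paid : bool := (i <= j)%N && all_caught s' a.

(** Refreshing clears the bits below [i]. Server [i] lands on [a_t], which is its own point exactly
    when [i] is the target, the lowest clear bit. *)
Lemma matched_step (n : nat) : (n < k)%N ->
  matched s' a' n =
  (if paid then (n != j) else true) && counter_step (matched s a) i n.
Proof.
move=> nk; rewrite -[n]/(val (Ordinal nk)); move: (Ordinal nk) => {nk} {}n /=.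
rewrite matchedE /paid.
case: (boolP (overtaken s s' a n)) => [ov|nov].
  rewrite (negbTE (refresh_neq _ _ _ ov)).
  move: ov; rewrite overtakenE => /orP[ni|/andP[/eqP -> ->]].
    by rewrite counter_step_lt // andbF.
  rewrite andbT eqxx; case: leqP => // ji.
  by rewrite counter_step_lt.
have -> : a' n = a n by rewrite /a' /= refreshF.
move: nov; rewrite overtakenE negb_or -leqNgt negb_and => /andP[ni nj].
have -> : (if (i <= j)%N && all_caught s' a then (n : nat) != j else true) = true.
  case: ifP => // /andP[_ ac]; move: nj; rewrite ac orbF.
  by apply: contra => /eqP /val_inj ->.
rewrite alg_stepE /=; have [->|ni'] := eqVneq n i.
  rewrite counter_step_id matchedE.
  have [tP t_min] := targetP.
  apply/eqP/andP => [/(valid_inj sa_valid) <-|[siP /forallP H]].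
    split=> //; apply/forallP => l; have lk := ltn_trans (ltn_ord l) (ltn_ord t).
    by rewrite -[val l]/(val (Ordinal lk)) matchedE t_min /= ?eqxx ?ltn_ord.
  congr (a _); apply: val_inj; case: (ltngtP t i) => //= [ti|it].
    by have := H (Ordinal ti); rewrite /= matchedE (negbTE tP).
  by rewrite t_min ?eqxx in siP.
rewrite counter_step_gt ?matchedE // ltn_neqAle ni andbT eq_sym.
by apply: contra ni' => /eqP /val_inj ->.
Qed.

(** For [valid_neq]: [a_l] is fresh if [l < i], and otherwise a server [m > l] has not moved. For
    [valid_escape]: once everything from [j] on is caught, [a_j] is refreshed. *)
Lemma valid_step : p i != 0 -> valid s' a'.
Proof.
move=> pi0; split.
- by apply: refresh_inj => l m _ _; apply: (valid_inj sa_valid).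
- move=> l m lm; case: (boolP (overtaken s s' a l)) => ov; first exact: refresh_neq.
  rewrite /a' /= refreshF //.
  move: ov; rewrite overtakenE negb_or -leqNgt => /andP[il _].
  have im := leq_ltn_trans il lm.
  by rewrite alg_stepE -val_eqE /= gtn_eqF // (valid_neq sa_valid).
- case: (boolP (overtaken s s' a j)) => [ov|]; first by exists j => //; exact: refresh_neq.
  rewrite overtakenE eqxx /= negb_or => /andP[_ /forallPn[m]].
  rewrite negb_imply => /andP[jm sm]; exists m => //.
  case: (boolP (overtaken s s' a m)) => ov; first exact: refresh_neq.
  by rewrite /a' /= refreshF.
move=> m; case: (boolP (overtaken s s' a m)) => [ov /eqP|ov].
  by rewrite (negbTE (refresh_neq _ _ _ ov)).
rewrite /a' /= refreshF // alg_stepE.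
by case: eqP => [-> //|_]; apply: (valid_pos sa_valid).
Qed.

Variable beta : 'I_k -> R.
Hypothesis beta_gt0 : forall l, 0 < beta l.

Lemma adv_move_le : move_cost beta a a' <=
  \sum_(l < k | (l < i)%N) beta l + beta j * paid%:R.
Proof.
rewrite /move_cost [X in _ <= X + _]big_mkcond /=.
rewrite (_ : beta j * paid%:R = \sum_(l < k) beta l * ((l == j) && paid)%:R).
  rewrite -big_split /=; apply: ler_sum => l _; rewrite /udist.
  have b0 := ltW (beta_gt0 l).
  case: (boolP (overtaken s s' a l)) => ov; last first.
    rewrite /a' /= refreshF // eqxx mulr0 addr_ge0 ?mulr_ge0 //.
    by case: ifP.
  move: ov; rewrite overtakenE /paid; case: ifP => [_ _|li /=].
    by rewrite -[X in X <= _]addr0 lerD ?mulr_ge0 // ler_piMr // lern1 leq_b1.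
  move=> /andP[/eqP lj ->]; rewrite lj eqxx add0r.
  by rewrite -lj leqNgt li /= ler_wpM2l // lern1 leq_b1.
rewrite (bigD1 j) //= eqxx big1 ?addr0 // => l /negbTE ->.
by rewrite mulr0.
Qed.

Lemma alg_move : move_cost beta s s' = beta i.
Proof.
rewrite /move_cost (bigD1 i) //= /udist alg_step_neq eqxx mulr1 big1 ?addr0 //.
by move=> l /negbTE li; rewrite alg_step_neq li mulr0.
Qed.

End Step.

End Chase.

(** * Expected costs of both players under strategy [j] *)

Section Rates.

Variables (R : realType) (k : nat) (beta p : 'I_k -> R).
Hypothesis beta_gt0 : forall i, 0 < beta i.
Hypothesis p_ge0 : forall i, 0 <= p i.
Hypothesis p_sum1 : \sum_(i < k) p i = 1.

Definition ext0 (n : nat) : R := oapp p 0 (insub n).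

Lemma ext0E (i : 'I_k) : ext0 i = p i.
Proof. by rewrite /ext0 valK. Qed.

Lemma ext0_ge0 n : 0 <= ext0 n.
Proof. by rewrite /ext0; case: (insub n) => [i|] /=. Qed.

Definition step_cost : R := \sum_(i < k) p i * beta i.

(** The part of the adversary's cost that fast growing weights make negligible. *)
Definition refresh_cost : R :=
  \sum_(i < k) p i * \sum_(l < k | (l < i)%N) beta l.

Variables (j : 'I_k) (s0 : config k nat).

Definition pot (s a : config k nat) : R :=
  phi ext0 j (k - j.+1) (matched s a).

Lemma subn_ord : (j + (k - j.+1)).+1 = k.
Proof. by rewrite -addSn subnKC. Qed.

Lemma pot_ge0 s a : 0 <= pot s a.
Proof. exact: phi_ge0 ext0_ge0 _ _ _. Qed.

(** A payment for [a_j] clears bit [j] in a state where all bits from [j] on are set, so [phi_pay]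
    compensates it exactly. *)
Lemma pot_step s a (i : 'I_k) : valid j p s a ->
  let s' := alg_step s (a (target j s a)) i in
  let a' := (react j (s, a) s').2 in
  (paid j s a i)%:R + pot s' a' =
    phi ext0 j (k - j.+1) (counter_step (matched s a) i).
Proof.
move=> v s' a'; rewrite /pot.
rewrite (eq_phi _ (h' := fun n => (if paid j s a i then n != j else true) &&
    counter_step (matched s a) i n)); last first.
  by move=> n; rewrite subn_ord => nk; apply: (matched_step v).
case: (boolP (paid j s a i)) => [/andP[ij /forallP ac]|_ /=]; last by rewrite add0r.
rewrite [RHS]phi_pay // => n; rewrite subn_ord => /andP[jn nk].
have /= := ac (Ordinal nk); rewrite jn /= (alg_stepE v) -val_eqE /= => sn.
rewrite /counter_step ltnNge (leq_trans ij jn) /=.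
move: sn; case: (eqVneq n i) => [ni|_] sn; last by rewrite -[n]/(val (Ordinal nk)) matchedE.
have [tP t_min] := targetP v.
(* Server [i] was moved to the target's point and is caught there, so it is the target. *)
have it : i = target j s a.
  by apply: val_inj; rewrite /= -ni (valid_inj v (eqP sn)).
rewrite matchedE it tP /=; apply/forallP => l.
have lk := ltn_trans (ltn_ord l) (ltn_ord (target j s a)).
by rewrite -[val l]/(val (Ordinal lk)) matchedE t_min //= ltn_ord.
Qed.

Lemma pot_drift s a : valid j p s a ->
  \sum_(i < k) p i * phi ext0 j (k - j.+1) (counter_step (matched s a) i) <=
    pot s a + rate ext0 j k.
Proof.
move=> v; rewrite /pot.
under eq_bigr do rewrite -ext0E.
have := @phi_step _ ext0 ext0_ge0 j (k - j.+1) (matched s a).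
rewrite subn_ord; apply.
- by under eq_bigr do rewrite ext0E; rewrite p_sum1.
- move=> n nk; rewrite -[n]/(val (Ordinal nk)) matchedE ext0E => /eqP.
  exact: (valid_pos v).
have [m jm sm] := valid_escape v.
by exists m; rewrite ?jm ?ltn_ord ?matchedE.
Qed.

Let chase_cost_rate : R := beta j * rate ext0 j k + refresh_cost.

Lemma alg_cost_chase n s a h :
  valid j p s a -> chase_state j s0 h = (s, a) ->
  expect n p (alg_cost beta (chase j s0) s h) = n%:R * step_cost.
Proof.
elim: n s a h => [|n IH] s a h v E; first by rewrite expect0 mul0r.
rewrite expectS /= /chase_request E /=.
transitivity (\sum_(i < k) (p i * beta i + p i * (n%:R * step_cost))).
  apply: eq_bigr => i _.
  (* Validity is preserved only for draws of nonzero probability; the others contribute nothing. *)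
  have [->|pi0] := eqVneq (p i) 0; first by rewrite !mul0r addr0.
  rewrite expect_const // -mulrDr (alg_move v) (IH _ _ _ (valid_step v pi0)) //.
  by rewrite /chase_state foldl_rcons -/(chase_state j s0 h) E.
by rewrite big_split /= -mulr_suml p_sum1 mul1r -natr1 mulrDl mul1r addrC.
Qed.

(** Amortization with the potential [beta j * pot]. The adversary still stands at [a0] and moves to
    [a] when it serves the next request. *)
Lemma adv_cost_chase n s a a0 h :
  valid j p s a -> chase_state j s0 h = (s, a) ->
  expect n p (adv_cost beta (chase j s0) a0 s h) <=
    move_cost beta a0 a + beta j * pot s a + n%:R * chase_cost_rate.
Proof.
have mc_ge0 (u v : config k nat) : 0 <= move_cost beta u v.
  by apply: sumr_ge0 => i _; rewrite mulr_ge0 // ltW.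
have bj := ltW (beta_gt0 j).
elim: n s a a0 h => [|n IH] s a a0 h v E.
  by rewrite expect0 mul0r addr0 addr_ge0 // mulr_ge0 ?pot_ge0.
rewrite expectS /= /chase_request E /=.
apply: (@le_trans _ _ (\sum_(i < k) p i * (move_cost beta a0 a +
    ((\sum_(l < k | (l < i)%N) beta l) +
     beta j * phi ext0 j (k - j.+1) (counter_step (matched s a) i) +
     n%:R * chase_cost_rate)))).
  apply: ler_sum => i _.
  have [->|pi0] := eqVneq (p i) 0; first by rewrite !mul0r.
  rewrite expect_const // ler_wpM2l // lerD2l.
  apply: le_trans (IH _ _ _ _ (valid_step v pi0) _) _.
    by rewrite /chase_state foldl_rcons -/(chase_state j s0 h) E.
  rewrite lerD2r -(pot_step i v) mulrDr addrA lerD2r.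
  exact: (adv_move_le v).
under eq_bigr do rewrite !mulrDr.
rewrite !big_split /= -!mulr_suml p_sum1 !mul1r.
under [X in _ + (_ + X + _)]eq_bigr do rewrite mulrCA.
rewrite -mulr_sumr -/refresh_cost.
have := ler_wpM2l bj (pot_drift v).
by rewrite /chase_cost_rate -[n.+1%:R]natr1; lra.
Qed.

End Rates.

(** * From long-run rates to the lower bound *)

Lemma bounded_linear (R : archiRealFieldType) (x C : R) :
  (forall n : nat, n%:R * x <= C) -> x <= 0.
Proof.
move=> nx_le; rewrite leNgt; apply/negP => x0.
have C0 : 0 <= C by have := nx_le 0; rewrite mul0r.
have := archi_boundP (divr_ge0 C0 (ltW x0)).
by rewrite ltr_pdivrMr // ltNge nx_le.
Qed.

Lemma competitive_le (R : realType) (k : nat) (A : memoryless_alg R k) (c c' : R) :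
  c <= c' -> competitive A c -> competitive A c'.
Proof.
move=> cc' Ac T s0; have [b H] := Ac T s0; exists b => beta beta_gt0 adv n.
apply: le_trans (H beta beta_gt0 adv n) _; rewrite lerD2r ler_wpM2r //.
apply: sumr_ge0 => w _; apply: mulr_ge0.
  by apply: prodr_ge0 => i _; apply: server_prob_ge0.
move: [::] s0 {1}s0 {H}; elim: (tval w) => //= i v IH h s a.
rewrite addr_ge0 //; apply: sumr_ge0 => l _.
by rewrite mulr_ge0 ?ler0n // ltW.
Qed.

(** Over [n] requests the additive constant, the initial move and the initial potential stay
    bounded, so only the costs per request survive. *)
Lemma competitive_rate (R : realType) (k : nat) (A : memoryless_alg R k) (c : R)
    (beta : 'I_k -> R) (j : 'I_k) :
  0 <= c -> competitive A c -> (forall i, 0 < beta i) ->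
  step_cost beta (A beta) <=
    c * (beta j * rate (ext0 (A beta)) j k + refresh_cost beta (A beta)).
Proof.
move=> c0 Ac beta_gt0.
pose s0 : config k nat := [ffun=> 0%N].
have [b /(_ beta beta_gt0 (chase j s0)) H] := Ac _ s0.
have p0 := server_prob_ge0 A beta_gt0; have p1 := server_prob_sum1 A beta_gt0.
have v := valid_start j (A beta) s0.
rewrite -subr_le0.
apply: (@bounded_linear _ _ (c * (move_cost beta s0 (start s0).2 +
   beta j * pot (A beta) j s0 (start s0).2) + b)) => n.
have := H n; rewrite (alg_cost_chase beta p1 n v) //.
have := ler_wpM2l c0
  (adv_cost_chase beta_gt0 p0 p1 n s0 v (erefl : chase_state j s0 [::] = _)).
set x := expect _ _ _; rewrite !mulrDr mulrN; lra.
Qed.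

Lemma sum_rates (R : realType) (k : nat) (beta p : 'I_k -> R) :
  \sum_(j < k) (alphar R j + 2)^-1 * (beta j * rate (ext0 p) j k) =
  step_cost beta p / (alphar R k + 1).
Proof.
rewrite mulr_suml; apply: eq_bigr => j _; rewrite /rate ext0E.
have := alphar1_gt0 R k; have := alphar2_gt0 R j => h1 h2.
by field; rewrite !gt_eqF.
Qed.

(** Powers of a large base. The bound holds for each [i], hence under whatever distribution the
    algorithm chooses for these weights. *)
Lemma geometric_weights (R : realFieldType) (k : nat) (e : R) : 0 < e ->
  exists beta : 'I_k -> R, (forall i, 1 <= beta i) /\
    forall i : 'I_k, \sum_(l < k | (l < i)%N) beta l <= e * beta i.
Proof.
move=> e0; have [k0|k_gt0] := posnP k.
  by exists (fun=> 1); split=> // -[i ik]; exfalso; rewrite k0 in ik.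
have kR : 0 < k%:R :> R by rewrite ltr0n.
have K0 : 0 < k%:R / e by rewrite divr_gt0.
(* As [K >= k / e], each of the at most [k] lower weights is at most [e / k] times [beta i]. *)
pose K : R := 1 + k%:R / e; have K1 : 1 <= K by rewrite lerDl ltW.
have KX n : 0 <= K ^+ n by rewrite exprn_ge0 // (le_trans ler01).
exists (fun i : 'I_k => K ^+ i); split=> i; first exact: exprn_ege1.
have -> : e * K ^+ i = \sum_(l < k) e / k%:R * K ^+ i.
  by rewrite sumr_const card_ord -mulr_natl; field; rewrite gt_eqF.
rewrite big_mkcond; apply: ler_sum => l _; case: ifP => [li|_].
  rewrite -ler_pdivrMl ?divr_gt0 // invf_div.
  apply: (@le_trans _ _ (K ^+ l.+1)); last by rewrite ler_weXn2l.
  by rewrite exprS ler_wpM2r // lerDr ler01.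
by rewrite mulr_ge0 // ltW // divr_gt0.
Qed.

Theorem theorem2 (R : realType) (k : nat) (hk : (1 <= k)%N) :
  ~ exists A : memoryless_alg R k,
      (competitive_ratio A < ((alpha k)%:R%R : R)%:E)%E.
Proof.
case=> A /ereal_inf_lt[_ [c0 /= Ac0 <-]]; rewrite lte_fin -/(alphar R k) => c0_lt.
have a0 : 0 < alphar R k.
  by rewrite ltr0n; case: k hk {A Ac0 c0_lt} => [|n] // _; rewrite alphaS addn1.
(* The adversary's cost is only bounded from above, so the ratio has to be nonnegative. *)
pose c := Num.max c0 0.
have c_ge0 : 0 <= c by rewrite le_max lexx orbT.
have c_lt : c < alphar R k by rewrite gt_max c0_lt.
have {Ac0}Ac : competitive A c by apply: competitive_le Ac0; rewrite le_max lexx.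
set a := alphar R k in a0 c_lt.
(* Averaging will give [a <= c * (1 + e * a)]; this [e] makes the right side at most
   [c + (a - c) / 2], which is below [a]. *)
pose e := (a - c) / (2 * a ^+ 2).
have e0 : 0 < e by rewrite divr_gt0 ?subr_gt0 // mulr_gt0 ?exprn_gt0.
have [beta [beta1 beta_sum]] := geometric_weights k e0.
have beta0 i : 0 < beta i := lt_le_trans ltr01 (beta1 i).
have p0 := server_prob_ge0 A beta0; have p1 := server_prob_sum1 A beta0.
set g := step_cost beta (A beta).
have g0 : 0 < g.
  apply: lt_le_trans ltr01 _; rewrite -[leLHS]p1.
  by apply: ler_sum => i _; rewrite ler_peMr.
have refresh_le : refresh_cost beta (A beta) <= e * g.
  rewrite mulr_sumr; apply: ler_sum => i _.
  by rewrite mulrCA ler_wpM2l.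
have : \sum_(j < k) (alphar R j + 2)^-1 * g <=
    \sum_(j < k) (alphar R j + 2)^-1 *
      (c * (beta j * rate (ext0 (A beta)) j k + e * g)).
  apply: ler_sum => j _; rewrite ler_wpM2l ?invr_ge0 ?(ltW (alphar2_gt0 _ _)) //.
  apply: le_trans (competitive_rate j c_ge0 Ac beta0) _.
  by rewrite ler_wpM2l // lerD2l.
under [leRHS]eq_bigr do rewrite mulrCA mulrDr.
rewrite -mulr_sumr big_split /= sum_rates -!mulr_suml sum_inv_alphar2 -/a -/g.
have -> : a / (a + 1) * g = g / (a + 1) * a by ring.
have -> : c * (g / (a + 1) + a / (a + 1) * (e * g)) =
    g / (a + 1) * (c * (1 + e * a)) by ring.
have f0 : 0 < g / (a + 1) by rewrite divr_gt0 // alphar1_gt0.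
rewrite (ler_pM2l f0) leNgt => /negP; apply.
have -> : c * (1 + e * a) = c + (a - c) * (c / a) / 2.
  by rewrite /e; field; rewrite gt_eqF.
have : (a - c) * (c / a) <= (a - c) * 1.
  by rewrite ler_wpM2l ?subr_ge0 ?ler_pdivrMr ?mul1r // ltW.
by move: c_lt; lra.
Qed.
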